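(* Let $q\ge 1$ be an integer and let $X$ be a connected, undirected, simple $(q+1)$-regular graph with a finite or countably infinite vertex set $V(X)$ and a fixed base point $x_0\in V(X)$. Let $a\in\mathbb{R}$ and $b\in\mathbb{R}\setminus\{0\}$ satisfy the spectral-edge condition: $a\le 0$ if $b>0$; and, if $b<0$, $a\le -|b|\max\{\lambda_{\max},(\sqrt q+1)^2\}$ when $X$ is finite (where $\lambda_{\max}$ is the largest eigenvalue of the combinatorial Laplacian $\Delta_X$) and $a\le -|b|(\sqrt q+1)^2$ when $X$ is infinite. Set $$c_{a,b}=\frac{2b\sqrt q}{b(q+1)-a},\qquad d_{a,b}=b(q+1)-a.$$ Then the discrete-time wave kernels $W_X^{a,b}(x_0,x;t)$ and $V_X^{a,b}(x_0,x;t)$ associated with $\Delta_X^{a,b}=b\Delta_X-aI$ are given, for all $x\in V(X)$ and $t\in\mathbb{N}_0$, by $$W_X^{a,b}(x_0,x;t)=\sum_{k=0}^{\lfloor t/2\rfloor}(-1)^k\binom{t}{2k}d_{a,b}^k\sum_{m=0}^k(-1)^m b_m(x)\,q^{-m/2}\,I_m^{c_{a,b}}(k),$$ $$V_X^{a,b}(x_0,x;t)=\sum_{k=0}^{\lfloor (t-1)/2\rfloor}(-1)^k\binom{t}{2k+1}d_{a,b}^k\sum_{m=0}^k(-1)^m b_m(x)\,q^{-m/2}\,I_m^{c_{a,b}}(k).$$ Furthermore, if $x=x_0$ and $X$ is vertex-transitive, then for all $t\in\mathbb{N}_0$ $$W_X^{a,b}(x_0,x_0;t)=\sum_{k=0}^{\lfloor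 t/2\rfloor}(-1)^k\binom{t}{2k}d_{a,b}^k\left(\sum_{m=0}^k(-1)^mN_m(x_0)\,q^{-m/2}I_m^{c_{a,b}}(k)+(1-q)\sum_{j=1}^{\lfloor k/2\rfloor}q^{-j}I_{2j}^{c_{a,b}}(k)\right)$$ and $$V_X^{a,b}(x_0,x_0;t)=\sum_{k=0}^{\lfloor (t-1)/2\rfloor}(-1)^k\binom{t}{2k+1}d_{a,b}^k\left(\sum_{m=0}^k(-1)^mN_m(x_0)\,q^{-m/2}I_m^{c_{a,b}}(k)+(1-q)\sum_{j=1}^{\lfloor k/2\rfloor}q^{-j}I_{2j}^{c_{a,b}}(k)\right).$$
   Context: Combinatorial Laplacian: $\Delta_Xf(x)=(q+1)f(x)-\sum_{y\sim x}f(y)$ for $f:V(X)\to\mathbb{R}$; generalized Laplacian: $\Delta_X^{a,b}=b\Delta_X-aI$. Forward differences in $t\in\mathbb{N}_0$: $\partial_tu(t)=u(t+1)-u(t)$, $\partial_t^2u(t)=u(t+2)-2u(t+1)+u(t)$. The discrete-time wave kernels $W_X^{a,b},V_X^{a,b}:V(X)\times V(X)\times\mathbb{N}_0\to\mathbb{R}$ are the solutions of $\Delta_X^{a,b}W(x_0,x;t)+\partial_t^2W(x_0,x;t)=0$ (Laplacian acting in $x$) with initial conditions: $W_X^{a,b}(x_0,x;0)=1$ if $x=x_0$ and $0$ otherwise, $\partial_tW_X^{a,b}(x_0,x;0)=0$ for all $x$; respectively $V_X^{a,b}(x_0,x;0)=0$ for all $x$, and $\partial_tV_X^{a,b}(x_0,x;0)=1$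 if $x=x_0$ and $0$ otherwise. Discrete $I$-Bessel function: for $t,n\in\mathbb{N}_0$ with $n\le t$ and $c\in\mathbb{C}$, $$I_n^c(t)=\sum_{\ell=0}^{\lfloor (t-n)/2\rfloor}\frac{t!}{\ell!\,(t-2\ell-n)!\,(n+\ell)!}\left(\frac c2\right)^{2\ell+n},$$ and $I_n^c(t)=0$ for $n>t$ (with $0^0=1$). A non-backtracking walk is a walk in which no edge is immediately followed by its reversal. For $x\in V(X)$, $c_m(x)$ is the number of non-backtracking walks of length $m$ from $x_0$ to $x$ (so $c_0(x)=1$ if $x=x_0$ and $0$ otherwise). Put $b_0(x)=c_0(x)$, $b_1(x)=c_1(x)$, and for $m\ge2$ $$b_m(x)=c_m(x)+(1-q)\big(c_{m-2}(x)+c_{m-4}(x)+\dots+c_*(x)\big),$$ where $c_*(x)=c_0(x)$ if $m$ is even and $c_*(x)=c_1(x)$ if $m$ is odd. When $X$ is vertex-transitive, $N_m(x_0)$ is the number of non-backtracking walks of length $m$ from $x_0$ to itself without tails, i.e. closed non-backtracking walks whose last step is not the reversal of its first step; by convention $N_0(x_0)=1$. Empty sums are $0$. *)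

(* Defs.v *)
From HB Require Import structures.
From mathcomp Require Import all_boot all_order all_algebra finmap.
From mathcomp Require Import boolp classical_sets functions cardinality fsbigop.
From mathcomp Require Import reals ring.

Set Implicit Arguments.
Unset Strict Implicit.
Unset Printing Implicit Defensive.

Import Order.TTheory GRing.Theory Num.Theory.
Local Open Scope classical_set_scope.
Local Open Scope card_scope.
Local Open Scope ring_scope.

(* A graph is given by its adjacency relation [e] on a countable type of
   vertices. *)

Definition simple_graph (V : countType) (e : rel V) : Prop :=
  symmetric e /\ irreflexive e.

Definition connected_graph (V : countType) (e : rel V) : Prop :=
  forall x y : V, exists2 p : seq V, path e x p & last x p = y.

Definition regular_graph (V : countType) (e : rel V) (d : nat) : Prop :=
  forall x : V, [set y | e x y] #= `I_d.

Definition vertex_transitive (V : countType) (e : rel V) : Prop :=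
  forall x y : V, exists phi : V -> V,
    [/\ bijective phi, forall u v, e (phi u) (phi v) = e u v & phi x = y].

(* [fsbigop] sums have finite support by definition; in a regular graph
   neighbourhoods are finite, so this is the full sum over the neighbours. *)
Definition laplacian (R : realType) (V : countType) (e : rel V) (q : nat)
    (f : V -> R) (x : V) : R :=
  (q.+1)%:R * f x - \sum_(y \in [set y | e x y]) f y.

Definition gen_laplacian (R : realType) (V : countType) (e : rel V) (q : nat)
    (a b : R) (f : V -> R) (x : V) : R :=
  b * laplacian e q f x - a * f x.

Definition is_eigenvalue (R : realType) (V : countType) (e : rel V) (q : nat)
    (lam : R) : Prop :=
  exists2 f : V -> R, (exists x, f x != 0) &
    forall x, laplacian e q f x = lam * f x.

Definition is_lambda_max (R : realType) (V : countType) (e : rel V) (q : nat)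
    (lam : R) : Prop :=
  is_eigenvalue e q lam /\ forall mu : R, is_eigenvalue e q mu -> mu <= lam.

Definition spectral_edge (R : realType) (V : countType) (e : rel V) (q : nat)
    (a b : R) : Prop :=
  [/\ 0 < b -> a <= 0,
      b < 0 -> finite_set [set: V] ->
        exists2 lam : R, is_lambda_max e q lam &
          a <= - `|b| * Num.max lam ((Num.sqrt q%:R + 1) ^+ 2)
    & b < 0 -> infinite_set [set: V] ->
        a <= - `|b| * (Num.sqrt q%:R + 1) ^+ 2].

Definition fdiff (R : realType) (u : nat -> R) (t : nat) : R := u t.+1 - u t.

Definition fdiff2 (R : realType) (u : nat -> R) (t : nat) : R :=
  u t.+2 - 2 * u t.+1 + u t.

Definition solves_wave (R : realType) (V : countType) (e : rel V) (q : nat)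
    (a b : R) (u : V -> nat -> R) : Prop :=
  forall x t, gen_laplacian e q a b (u^~ t) x + fdiff2 (u x) t = 0.

Definition wave_ivp (R : realType) (V : countType) (e : rel V) (q : nat)
    (a b : R) (f g : V -> R) (u : V -> nat -> R) : Prop :=
  [/\ solves_wave e q a b u, forall x, u x 0%N = f x
    & forall x, fdiff (u x) 0 = g x].

Definition is_wave_kernel_W (R : realType) (V : countType) (e : rel V)
    (q : nat) (a b : R) (x0 : V) (W : V -> nat -> R) : Prop :=
  wave_ivp e q a b (fun x => (x == x0)%:R) (fun=> 0) W.

Definition is_wave_kernel_V (R : realType) (V : countType) (e : rel V)
    (q : nat) (a b : R) (x0 : V) (U : V -> nat -> R) : Prop :=
  wave_ivp e q a b (fun=> 0) (fun x => (x == x0)%:R) U.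

(* The initial value problem is well posed, so the two predicates above each
   determine exactly one kernel. *)
Lemma wave_ivp_exists_unique (R : realType) (V : countType) (e : rel V)
    (q : nat) (a b : R) (f g : V -> R) :
  exists! u : V -> nat -> R, wave_ivp e q a b f g u.
Proof.
pose step (p : (V -> R) * (V -> R)) :=
  (p.2, fun x => 2 * p.2 x - p.1 x - gen_laplacian e q a b p.1 x).
pose sol t := iter t step (f, fun x => f x + g x).
exists (fun x t => (sol t).1 x); split.
  split=> // [x t|x]; last by rewrite /fdiff /= addrC addKr.
  rewrite /fdiff2 /= -/(sol t).
  move: (gen_laplacian _ _ _ _ _ _) => L; move: ((sol t).1 x) => y.
  by move: ((sol t).2 x) => z; ring.
move=> v [eqv v0 v1].
suff H t : (sol t).1 = v^~ t /\ (sol t).2 = v^~ t.+1.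
  by apply/funext => x; apply/funext => t; have [-> _] := H t.
elim: t => [|t [IH1 IH2]].
  split; apply/funext => x /=; first by rewrite v0.
  by rewrite -v0 -v1 /fdiff addrC subrK.
split=> //=; rewrite -/(sol t) IH1 IH2; apply/funext => x /=.
have := eqv x t; rewrite /fdiff2 => /eqP; rewrite addr_eq0 => /eqP ->.
by ring.
Qed.

(* The walk x, p_1, ..., p_m is represented by its start [x] and the sequence
   [p] of its later vertices. In a simple graph the edge (w_i, w_{i+1}) is
   immediately followed by its reversal iff w_{i+2} = w_i. *)
Definition is_nb_walk (V : countType) (e : rel V) (m : nat) (x y : V)
    (p : seq V) : Prop :=
  [/\ size p = m, path e x p, last x p = y
    & forall i, (i.+2 <= m)%N -> nth x (x :: p) i != nth x (x :: p) i.+2].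

(* A closed walk (w_0, ..., w_m) has a tail iff its last step (w_{m-1}, w_m)
   is the reversal of its first step (w_0, w_1), i.e. iff w_{m-1} = w_1. *)
Definition is_tailless (V : countType) (m : nat) (x : V) (p : seq V) : Prop :=
  nth x (x :: p) m.-1 != nth x (x :: p) 1.

(* [fset_set] is the underlying finite set of a finite set (and is empty on an
   infinite one; sets of walks of given length in a regular graph are finite). *)
Definition nb_count (V : countType) (e : rel V) (x0 : V) (m : nat) (x : V)
    : nat :=
  #|` fset_set [set p : seq V | is_nb_walk e m x0 x p]|.

Definition N_count (V : countType) (e : rel V) (x0 : V) (m : nat) : nat :=
  if m is 0 then 1
  else #|` fset_set [set p : seq V | is_nb_walk e m x0 x0 p
                                     /\ is_tailless m x0 p]|.

(* The sum is c_{m-2} + c_{m-4} + ... down to c_0 or c_1; it is empty for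
   m < 2. *)
Definition b_coef (R : realType) (V : countType) (e : rel V) (q : nat) (x0 : V)
    (m : nat) (x : V) : R :=
  (nb_count e x0 m x)%:R
  + (1 - q%:R) * \sum_(1 <= j < m./2.+1) (nb_count e x0 (m - 2 * j) x)%:R.

Definition besselI (F : numFieldType) (n : nat) (c : F) (t : nat) : F :=
  if (n <= t)%N then
    \sum_(0 <= l < ((t - n)./2).+1)
      (t`!)%:R / (l`! * (t - 2 * l - n)`! * (n + l)`!)%:R
      * (c / 2) ^+ (2 * l + n)
  else 0.

Definition c_ab (R : realType) (q : nat) (a b : R) : R :=
  2 * b * Num.sqrt q%:R / (b * (q.+1)%:R - a).

Definition d_ab (R : realType) (q : nat) (a b : R) : R :=
  b * (q.+1)%:R - a.

(* Main.v *)
Require Import Defs.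
From HB Require Import structures.
From mathcomp Require Import all_boot all_order all_algebra finmap.
From mathcomp Require Import boolp classical_sets functions cardinality fsbigop.
From mathcomp Require Import reals ring lra zify.

(** The wave equation is a two-step recursion in t, and the second difference
of the binomial coefficient C(t, j+2) is C(t, j).  Hence, if w_k = L^k w_0 are
the iterates of the Laplacian L = d I - b A on the Dirac mass w_0 at x0 (A is
the adjacency operator), the kernels are the sums of (-1)^k C(t, 2k) w_k and of
(-1)^k C(t, 2k+1) w_k ([wave_series_solves]).  Everything reduces to computing
w_k.

Put s = sqrt q and B_m = b_m / s^m.  Counting the walks obtained by adding one
step to a non-backtracking walk gives
A c_(m+1) = c_(m+2) + (q + [m = 0]) c_m ([nb_count_adjS]), and the correction
terms in b_m turn this into the recurrence of the functions z^m + z^-m under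
multiplication by z + 1/z (with 1 in place of 2 for m = 0): A B_m / s is B_1,
B_2 + 2 B_0 or B_(m+1) + B_(m-1), for m = 0, 1 or larger.  The numbers I_m(k)
are the coefficients of (1 + (c/2)(z + 1/z))^k and obey the matching recurrence
in k ([besselI0S], [besselISS]).  Since b s = d c / 2 for c = c_ab and d = d_ab,
L acts as d (I - (c/2) A/s); a summation by parts ([sum_besselIS]) then shows
by induction on k that w_k = d^k sum_m (-1)^m B_m I_m(k) ([lap_iterS]).
The spectral-edge condition gives d != 0 ([d_ab_neq0]), by which c_ab divides.

For a vertex-transitive graph, write c_m(x) from here on for the number of closed
non-backtracking walks at x.  It remains to see that b_m(x0) = N_m + (1 - q) for
even m >= 2 and b_m(x0) = N_m otherwise ([b_coef_closed]), that is,
c_(m+2) - q c_m = N_(m+2) - N_m at x0 for m >= 1.  Let K_n be the n-th power of the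
non-backtracking operator on directed edges.  The closed walks at y whose tail is
the edge y x are counted by H_m(y,x) = K_(m-1)((y,x),(x,y)); removing the tail
and using inclusion-exclusion on the first and last step of what is left gives
H_(m+2)(y,x) = c_m(x) - T_m(x,y) - T_m(y,x) - H_m(x,y), where
T_m(x,y) = K_m((x,y),(x,y)) ([tail_edgeE]).  As c_m(x) does not depend on x, an
induction shows that H_m is symmetric ([tail_edge_sym]).  This replaces the
usual averaging over all vertices, which is not available on an infinite graph.
T_m is symmetric by reversal of walks, N_m(y) is the sum of T_m(y,x) over x, and
c_m = N_m + sum_x H_m; summing over the neighbours x of y gives the claim
([closed_count_step]). *)

Set Implicit Arguments.
Unset Strict Implicit.
Unset Printing Implicit Defensive.

Import Order.TTheory GRing.Theory Num.Theory.
Local Open Scope ring_scope.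

(** * Neighbour lists *)

Section Neighbours.
Variables (V : countType) (e : rel V) (q : nat).

Definition nbrs (x : V) : seq V :=
  enum_fset (fset_set [set y | e x y]%classic).

Hypothesis e_regular : regular_graph e q.+1.

Lemma nbrs_finite x : finite_set [set y | e x y]%classic.
Proof. by apply/finite_setP; exists q.+1. Qed.

Lemma mem_nbrs x y : (y \in nbrs x) = e x y.
Proof.
have := in_fset_set (nbrs_finite x) y; rewrite /nbrs /= => ->.
by apply/idP/idP; rewrite inE.
Qed.

Lemma nbrs_uniq x : uniq (nbrs x).
Proof. exact: fset_uniq. Qed.

Lemma size_nbrs x : size (nbrs x) = q.+1.
Proof. exact: (card_fset_set (e_regular x)). Qed.

End Neighbours.

(** * The non-backtracking edge operator *)

Section NonBacktracking.
Variables (R : comNzRingType) (V : countType) (e : rel V) (q : nat).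
Hypotheses (e_sym : symmetric e) (e_irr : irreflexive e).
Hypothesis e_regular : regular_graph e q.+1.
Implicit Types (F G : V -> V -> R) (g : V -> R) (a b c d u v x y : V).
Local Notation nbrs := (nbrs e).

(** The Hashimoto operator: F is a function of directed edges, and the result
sums F over the edges that can follow (a, b) in a non-backtracking walk.  It is
written on all pairs of vertices, so most identities hold on edges only. *)
Definition hashimoto F a b : R := \sum_(u <- nbrs b | u != a) F b u.

Lemma sum_nbrs_but x y (f : V -> R) : e x y ->
  \sum_(u <- nbrs x | u != y) f u = \sum_(u <- nbrs x) f u - f y.
Proof.
move=> exy; rewrite [in RHS](bigD1_seq y) /= ?nbrs_uniq //.
  by rewrite addrC addrK.
by rewrite (mem_nbrs e_regular).
Qed.

Lemma hashimotoE F a b : e a b ->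
  hashimoto F a b = \sum_(u <- nbrs b) F b u - F b a.
Proof. by move=> eab; rewrite /hashimoto sum_nbrs_but // e_sym. Qed.

(** Sum of g over the endpoints of the non-backtracking walks of length n that
start at x. *)
Definition nb_sum n g x : R :=
  if n is k.+1 then
    \sum_(u <- nbrs x) iter k hashimoto (fun _ v => g v) x u
  else g x.

(** A non-backtracking walk from a neighbour y of x, preceded by the step x y,
either stays non-backtracking or starts with x y x.  In the second case the
remaining walk from x avoids y as its first vertex, which leaves q choices for
y, or q + 1 if that walk is empty. *)
Lemma nb_sum_adj n g x :
  \sum_(y <- nbrs x) nb_sum n.+1 g y
  = nb_sum n.+2 g x + (q + (n == 0))%:R * nb_sum n g x.
Proof.
set G : V -> V -> R := fun _ v => g v.
have in_e y : y \in nbrs x -> e x y by rewrite (mem_nbrs e_regular).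
transitivity (nb_sum n.+2 g x + \sum_(y <- nbrs x) iter n hashimoto G y x).
  rewrite /nb_sum -big_split /=; apply: eq_big_seq => y /in_e exy.
  by rewrite hashimotoE // subrK.
congr (_ + _); case: n => [|n] /=.
  rewrite big_const_seq iter_addr_0 count_predT (size_nbrs e_regular).
  by rewrite addn1 mulr_natl.
rewrite addn0.
rewrite (eq_big_seq (fun y => nb_sum n.+1 g x - iter n hashimoto G x y));
  last first.
  by move=> y /in_e exy; rewrite hashimotoE // e_sym.
rewrite big_split /= sumrN big_const_seq iter_addr_0 count_predT.
by rewrite (size_nbrs e_regular) mulrSr addrK mulr_natl.
Qed.

Definition edge_dirac c d a b : R := ((a == c) && (b == d))%:R.

(** Number of non-backtracking walks of n + 1 edges whose first edge is
(a, b) and whose last edge is (c, d), when both are edges. *)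
Definition edge_kernel n a b c d : R := iter n hashimoto (edge_dirac c d) a b.
Local Notation K := edge_kernel.

Lemma iter_hashimoto_eq_edge n F G : (forall a b, e a b -> F a b = G a b) ->
  forall a b, e a b -> iter n hashimoto F a b = iter n hashimoto G a b.
Proof.
move=> FG; elim: n => //= n IHn a b eab.
rewrite /hashimoto big_seq_cond [RHS]big_seq_cond; apply: eq_bigr => u /andP[].
by rewrite (mem_nbrs e_regular) => /IHn ->.
Qed.

Lemma iter_hashimoto_sum n (s : seq V) (P : pred V) (F : V -> V -> V -> R) a b :
  iter n hashimoto (fun a b => \sum_(i <- s | P i) F i a b) a b
  = \sum_(i <- s | P i) iter n hashimoto (F i) a b.
Proof.
elim: n a b => //= n IHn a b; rewrite /hashimoto [RHS]exchange_big /=.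
by apply: eq_bigr => u _; exact: IHn.
Qed.

Lemma sum_indicator (s : seq V) (P : pred V) u : uniq s ->
  \sum_(i <- s | P i) (u == i)%:R = ((u \in s) && P u)%:R :> R.
Proof.
elim: s => [|i s IHs] /=; first by rewrite big_nil.
move=> /andP[i_s /IHs {}IHs]; rewrite big_cons inE.
have [ui|ui] := eqVneq u i; last by case: ifP => _; rewrite IHs ?add0r.
by rewrite IHs ui (negbTE i_s); case: ifP => // _; rewrite addr0.
Qed.

(** Splitting off the last edge instead of the first: powers of one operator
commute, so this only has to be checked for a single step. *)
Lemma edge_kernelSr n a b c d : e a b -> e c d ->
  K n.+1 a b c d = \sum_(v <- nbrs c | v != d) K n a b v c.
Proof.
move=> eab ecd; rewrite /K iterSr -iter_hashimoto_sum.
apply: iter_hashimoto_eq_edge eab => {}a {}b eab.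
rewrite /hashimoto /edge_dirac; have [bc|_] := eqVneq b c; last first.
  by rewrite !big1 // => i _; rewrite andbF.
under eq_bigr do rewrite andTb eq_sym.
under [RHS]eq_bigr do rewrite andbT.
rewrite bc !sum_indicator ?nbrs_uniq // !(mem_nbrs e_regular).
by rewrite -bc (e_sym b a) eab bc ecd eq_sym.
Qed.

(** Reversal of walks exchanges the recursion on the first edge with the one on
the last edge. *)
Lemma edge_kernel_rev n a b c d : e a b -> e c d -> K n a b c d = K n d c b a.
Proof.
elim: n a b c d => [|n IHn] a b c d eab ecd.
  by rewrite /edge_kernel /= /edge_dirac andbC (eq_sym a) (eq_sym b).
rewrite edge_kernelSr // /edge_kernel /= /hashimoto big_seq_cond [RHS]big_seq_cond.
apply: eq_bigr => v /andP[]; rewrite (mem_nbrs e_regular) => ecv _.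
by apply: IHn; rewrite // e_sym.
Qed.

Lemma iter_hashimoto_end n x a b : e a b ->
  iter n hashimoto (fun _ v => (v == x)%:R) a b = \sum_(v <- nbrs x) K n a b v x.
Proof.
move=> eab; rewrite -iter_hashimoto_sum.
apply: iter_hashimoto_eq_edge eab => {}a {}b eab; rewrite /edge_dirac.
have [<-|_] := eqVneq b x; last by rewrite big1 // => v _; rewrite andbF.
under eq_bigr do rewrite andbT.
by rewrite sum_indicator ?nbrs_uniq // (mem_nbrs e_regular) e_sym eab.
Qed.

Lemma nb_sumS n x y :
  nb_sum n.+1 (fun v => (v == y)%:R) x
  = \sum_(u <- nbrs x) \sum_(v <- nbrs y) K n x u v y.
Proof.
apply: eq_big_seq => u; rewrite (mem_nbrs e_regular) => exu.
exact: iter_hashimoto_end.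
Qed.

Lemma nb_sum_sym n x y :
  nb_sum n (fun v => (v == y)%:R) x = nb_sum n (fun v => (v == x)%:R) y.
Proof.
case: n => [|n]; first by rewrite /= eq_sym.
rewrite !nb_sumS exchange_big /=.
apply: eq_big_seq => v; rewrite (mem_nbrs e_regular) => eyv.
apply: eq_big_seq => u; rewrite (mem_nbrs e_regular) => exu.
by rewrite edge_kernel_rev // e_sym.
Qed.

Definition closed_count n x : R := nb_sum n (fun v => (v == x)%:R) x.

(** A closed walk of length k + 1 is tailless when its first edge can follow its
last one, so that appending its first edge gives a walk of k + 2 edges from an
edge to itself: the count is a diagonal of a power of [hashimoto]. *)
Definition tailless_count n x : R :=
  if n is k.+1 then \sum_(u <- nbrs x) K k.+1 x u x u else 1.

Lemma tailless_count_endE n x :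
  tailless_count n.+1 x
  = \sum_(u <- nbrs x) \sum_(v <- nbrs x | v != u) K n x u v x.
Proof.
apply: eq_big_seq => u; rewrite (mem_nbrs e_regular) => exu.
exact: edge_kernelSr.
Qed.

Lemma closed_countE n x : closed_count n.+1 x
  = tailless_count n.+1 x + \sum_(u <- nbrs x) K n x u u x.
Proof.
rewrite /closed_count nb_sumS tailless_count_endE -big_split /=.
apply: eq_big_seq => u; rewrite (mem_nbrs e_regular) => exu.
by rewrite sum_nbrs_but // subrK.
Qed.

(** Closed walks at y of length n + 3 with first edge (y, x) and last edge (x, y):
without these edges they are the closed walks at x of length n + 1 that neither
leave to y nor return from y.  The terms on the right are the inclusion-exclusion
count, where the walks leaving to y (or returning from y) are split into
tailless ones and those with tail x y. *)
Lemma tail_edgeE n x y : e x y ->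
  K n.+2 y x x y
  = closed_count n.+1 x - K n.+1 x y x y - K n.+1 y x y x - K n x y y x.
Proof.
move=> exy; have eyx : e y x by rewrite e_sym.
have -> : K n.+2 y x x y = \sum_(u <- nbrs x | u != y)
    (\sum_(v <- nbrs x) K n x u v x - K n x u y x).
  rewrite [LHS]big_seq_cond [RHS]big_seq_cond; apply: eq_bigr => u /andP[].
  rewrite (mem_nbrs e_regular) => exu _.
  by rewrite -sum_nbrs_but // -edge_kernelSr.
have -> : K n.+1 y x y x = \sum_(u <- nbrs x) K n x u y x - K n x y y x.
  exact: hashimotoE.
rewrite [closed_count _ _]nb_sumS edge_kernelSr // !sum_nbrs_but //.
rewrite big_split sumrN /=.
ring.
Qed.

Lemma tail_edge0 x y : e x y -> K 0 x y y x = 0.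
Proof.
move=> exy.
have /negbTE xy : x != y by apply: contraTneq exy => ->; rewrite e_irr.
by rewrite /edge_kernel /= /edge_dirac xy.
Qed.

Lemma tail_edge1 x y : K 1 x y y x = 0.
Proof.
rewrite /edge_kernel /= /hashimoto big1 // => w /negbTE wu.
by rewrite /edge_dirac wu andbF.
Qed.

Hypothesis closed_count_const : forall n x y, closed_count n x = closed_count n y.

(** The right-hand side of [tail_edgeE] is symmetric in x and y except for its
last term, which is the same quantity for walks shorter by 2. *)
Lemma tail_edge_sym n x y : e x y -> K n x y y x = K n y x x y.
Proof.
elim/ltn_ind: n x y => -[_|[_|n IHn]] x y exy.
- by rewrite !tail_edge0 // e_sym.
- by rewrite !tail_edge1.
have eyx : e y x by rewrite e_sym.
by rewrite !tail_edgeE // (closed_count_const _ y x) (IHn n) //; ring.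
Qed.

(** With c, N for the counts at length n + 1 and t = c - N for the walks with
tail, summing [tail_edgeE] over the q + 1 neighbours gives t' = (q + 1) c - 2 N - t
at length n + 3; that the last sum is t uses [tail_edge_sym].  Hence
c' - q c = N' + t' - q c = N' - N. *)
Lemma closed_count_step n x :
  closed_count n.+3 x - q%:R * closed_count n.+1 x
  = tailless_count n.+3 x - tailless_count n.+1 x.
Proof.
rewrite [closed_count n.+3 x]closed_countE.
rewrite (eq_big_seq (fun y => closed_count n.+1 x - K n.+1 x y x y
    - K n.+1 x y x y - K n x y y x)); last first.
  move=> y; rewrite (mem_nbrs e_regular) => exy.
  have eyx : e y x by rewrite e_sym.
  rewrite tail_edgeE // (closed_count_const _ y x) (edge_kernel_rev n.+1 eyx eyx).
  by rewrite -(tail_edge_sym n exy).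
have := closed_countE n x.
move: (closed_count n.+1 x) (tailless_count n.+3 x) => c N3 cE.
rewrite !big_split /= !sumrN big_const_seq iter_addr_0 count_predT.
rewrite (size_nbrs e_regular) -/(tailless_count n.+1 x) -mulr_natl cE mulrSr.
move: (tailless_count n.+1 x) (\sum_(u <- _) _) => N t; ring.
Qed.
End NonBacktracking.

(** * Automorphisms *)

Section Automorphisms.
Variables (R : comNzRingType) (V : countType) (e : rel V) (q : nat).
Hypothesis e_regular : regular_graph e q.+1.

Lemma perm_nbrs_aut (phi : V -> V) x : bijective phi ->
  (forall u v, e (phi u) (phi v) = e u v) ->
  perm_eq (nbrs e (phi x)) (map phi (nbrs e x)).
Proof.
move=> phi_bij phi_e; have phi_inj := bij_inj phi_bij.
apply: uniq_perm; rewrite ?map_inj_uniq ?nbrs_uniq // => z.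
have [psi phiK psiK] := phi_bij.
rewrite -[z]psiK (mem_map phi_inj) !(mem_nbrs e_regular); exact: phi_e.
Qed.

Lemma iter_hashimoto_aut (phi : V -> V) n (F : V -> V -> R) a b : bijective phi ->
  (forall u v, e (phi u) (phi v) = e u v) ->
  iter n (hashimoto e) F (phi a) (phi b)
  = iter n (hashimoto e) (fun u v => F (phi u) (phi v)) a b.
Proof.
move=> phi_bij phi_e; elim: n a b => //= n IHn a b.
rewrite /hashimoto (perm_big _ (perm_nbrs_aut b phi_bij phi_e)) big_map.
by apply: eq_big => u; rewrite ?(inj_eq (bij_inj phi_bij)).
Qed.

Lemma closed_count_transitive n x y : vertex_transitive e ->
  closed_count R e n x = closed_count R e n y.
Proof.
move=> /(_ x y)[phi [phi_bij phi_e <-]].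
rewrite /closed_count; case: n => [|n] /=; first by rewrite !eqxx.
rewrite (perm_big _ (perm_nbrs_aut x phi_bij phi_e)) big_map.
apply: eq_bigr => u _; rewrite iter_hashimoto_aut //.
congr (iter n _ _ _ _); apply/funext => _; apply/funext => v.
by rewrite (inj_eq (bij_inj phi_bij)).
Qed.
End Automorphisms.

(** * Enumeration of the non-backtracking walks *)

Section Enumeration.
Variables (V : countType) (e : rel V) (q : nat).
Hypothesis e_sym : symmetric e.
Hypothesis e_regular : regular_graph e q.+1.
Local Notation nbrs := (nbrs e).

(** The continuations of a walk that ends with a, b, listed along the recursion of
[hashimoto], so that a sum over walks is a power of that operator. *)
Fixpoint nb_ext n (a b : V) : seq (seq V) :=
  if n is k.+1 then
    [seq u :: s | u <- [seq u <- nbrs b | u != a], s <- nb_ext k b u]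
  else [:: [::]].

Lemma nb_ext_uniq n a b : uniq (nb_ext n a b).
Proof.
elim: n a b => //= n IHn a b.
apply: allpairs_uniq_dep => // [|[u s] [v t] _ _ [-> ->] //].
by rewrite filter_uniq ?nbrs_uniq.
Qed.

Lemma size_nb_ext n a b s : s \in nb_ext n a b -> size s = n.
Proof.
elim: n a b s => [|n IHn] a b s /=; first by rewrite inE => /eqP->.
by case/allpairsPdep => u [t [_ /IHn <- ->]].
Qed.

Lemma mem_nb_ext n x a b s : s \in nb_ext n a b <->
  [/\ size s = n, path e b s
    & forall i, (i < n)%N -> nth x (a :: b :: s) i != nth x (a :: b :: s) i.+2].
Proof.
elim: n a b s => [|n IHn] a b s /=.
  by split=> [|[/size0nil->]]; rewrite inE // => /eqP->.
split.
  case/allpairsPdep => u [t [+ /IHn[st pt nt] ->]].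
  rewrite mem_filter (mem_nbrs e_regular) => /andP[ua ebu].
  split; rewrite /= ?st ?ebu // => -[_|i /nt //].
  by rewrite eq_sym.
case: s => [[]//|u t] [[st]] /= /andP[ebu pt] nt.
apply/allpairsPdep; exists u, t; split=> //.
  by rewrite mem_filter (mem_nbrs e_regular) ebu eq_sym (nt 0).
by apply/IHn; split=> // i ilt; exact: (nt i.+1).
Qed.

Definition nb_walks n x : seq (seq V) :=
  [seq u :: s | u <- nbrs x, s <- nb_ext n x u].

Lemma nb_walks_uniq n x : uniq (nb_walks n x).
Proof.
apply: allpairs_uniq_dep => [|u _|[u s] [v t] _ _ [-> ->] //].
  exact: nbrs_uniq.
exact: nb_ext_uniq.
Qed.

Lemma mem_nb_walks n x y p :
  is_nb_walk e n.+1 x y p <-> p \in nb_walks n x /\ last x p = y.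
Proof.
split.
  case=> sp + <- np; case: p sp np => // u s [ss] np /= /andP[exu ps].
  split=> //; apply/allpairsPdep; exists u, s.
  by rewrite (mem_nbrs e_regular); split=> //; apply/(mem_nb_ext _ x).
case=> /allpairsPdep[u [s []]]; rewrite (mem_nbrs e_regular) => exu.
move=> /(mem_nb_ext _ x)[ss ps ns] -> <-.
by split; rewrite /= ?ss ?exu.
Qed.

Lemma card_fset_set_seq (T : choiceType) (A : set T) (s : seq T) :
  uniq s -> (forall x, A x <-> x \in s) -> #|` fset_set A| = size s.
Proof.
move=> us sA.
have finA : finite_set A.
  by apply/finite_seqP; exists s; apply/seteqP; split=> x /sA.
rewrite -(undup_id us) -card_fseq; congr #|` _|; apply/fsetP => x.
rewrite in_fset_set // !inE /=.
by apply/idP/idP => [/set_mem/sA|/sA/mem_set].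
Qed.

(** The vertex before the last one, in the form that follows the recursion of
[nb_ext]. *)
Lemma penultE (x a b : V) s : nth x (a :: b :: s) (size s) = last a (belast b s).
Proof. by elim: s a b => //= u s IHs a b; exact: IHs. Qed.

Lemma sum_nb_ext (R : comNzRingType) n (G : V -> V -> R) a b :
  \sum_(s <- nb_ext n a b) G (last a (belast b s)) (last b s)
  = iter n (hashimoto e) G a b.
Proof.
elim: n a b => [|n IHn] a b /=; first by rewrite big_seq1.
rewrite big_allpairs_dep big_filter; apply: eq_bigr => u _; exact: IHn.
Qed.

Lemma nb_count_nb_sum (R : comNzRingType) n x y :
  (nb_count e x n y)%:R = nb_sum e n (fun v => (v == y)%:R) x :> R.
Proof.
rewrite /nb_count; case: n => [|n].
  have [->|xy] := eqVneq x y.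
    rewrite (@card_fset_set_seq _ _ [:: [::]]) //= ?eqxx // => p.
    rewrite inE; split=> [[/size0nil->] // | /eqP->]; split=> //.
  rewrite (@card_fset_set_seq _ _ [::]) /= ?(negbTE xy) // => p; split=> //.
  by case=> /size0nil-> _ /= /eqP; rewrite (negbTE xy).
rewrite (@card_fset_set_seq _ _ [seq p <- nb_walks n x | last x p == y]).
- rewrite size_filter -sum1_count natr_sum big_mkcond big_allpairs_dep /=.
  apply: eq_bigr => u _; rewrite -sum_nb_ext; apply: eq_bigr => s _ /=.
  by case: ifP.
- by rewrite filter_uniq ?nb_walks_uniq.
move=> p; rewrite mem_filter; split=> [/mem_nb_walks[-> ->]|]; rewrite ?eqxx //.
by move=> /andP[/eqP lp pw]; apply/mem_nb_walks.
Qed.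

Lemma N_count_tailless (R : comNzRingType) n x :
  (N_count e x n)%:R = tailless_count R e n x.
Proof.
case: n => [|n] //; rewrite (tailless_count_endE _ e_sym e_regular) /N_count.
rewrite (@card_fset_set_seq _ _ [seq p <- nb_walks n x |
   (last x p == x) && (nth x (x :: p) n != nth x (x :: p) 1)]).
- rewrite size_filter -sum1_count natr_sum big_mkcond big_allpairs_dep /=.
  apply: eq_big_seq => u; rewrite (mem_nbrs e_regular) => exu.
  transitivity (iter n (hashimoto e)
    (fun v w => ((w == x) && (v != u))%:R : R) x u).
    rewrite -sum_nb_ext; apply: eq_big_seq => s /size_nb_ext <-.
    by rewrite penultE; case: ifP.
  rewrite -iter_hashimoto_sum.
  apply: (iter_hashimoto_eq_edge e_regular _ _ exu) => a b eab.
  rewrite /edge_dirac; have [bx|_] := eqVneq b x; last first.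
    by rewrite big1 // => v _; rewrite andbF.
  under eq_bigr do rewrite andbT.
  rewrite sum_indicator ?nbrs_uniq // (mem_nbrs e_regular) -bx e_sym eab.
  by [].
- by rewrite filter_uniq ?nb_walks_uniq.
move=> p; rewrite mem_filter; split.
  by move=> [/mem_nb_walks[-> ->]]; rewrite eqxx => ->.
by move=> /andP[/andP[/eqP lp tp] pw]; split=> //; apply/mem_nb_walks.
Qed.
End Enumeration.

(** * The discrete Bessel functions *)

Section Bessel.
Variable F : numFieldType.
Implicit Types (c : F) (n t : nat).

(** The multinomial coefficient as a product of binomial ones, which vanishes
outside the range of summation: N is free, and Pascal's rule applies. *)
Lemma besselI_binE n c t N : (t < N)%N ->
  besselI n c t
  = \sum_(0 <= l < N) ('C(t, 2 * l + n) * 'C(2 * l + n, l))%:R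
      * (c / 2) ^+ (2 * l + n).
Proof.
move=> tN; rewrite /besselI; case: leqP => [nt|tn]; last first.
  rewrite big1 // => l _; rewrite [X in (X * _)%N]bin_small ?mul0r //; lia.
have lN : (((t - n)./2).+1 <= N)%N by lia.
rewrite [RHS](big_cat_nat (leq0n _) lN) //= [X in _ + X]big1_seq ?addr0; last first.
  move=> l; rewrite mem_index_iota => /andP[_ /andP[+ _]] => lt.
  rewrite [X in (X * _)%N]bin_small ?mul0r //; lia.
apply: eq_big_nat => l /andP[_ lt]; congr (_ * _).
have sl : (2 * l + n <= t)%N by lia.
have ls : (l <= 2 * l + n)%N by lia.
rewrite -(bin_fact sl) -(bin_fact ls).
have -> : (2 * l + n - l = n + l)%N by lia.
rewrite subnDA !natrM.
have fact0 k : (k`!)%:R != 0 :> F by rewrite pnatr_eq0 -lt0n fact_gt0.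
by field; rewrite !fact0.
Qed.

(** The case n = 0 of the recurrence [besselISS], for the symmetric extension
I_(-1) = I_1. *)
Lemma besselI0S c t :
  besselI 0 c t.+1 = besselI 0 c t + c * besselI 1 c t.
Proof.
rewrite (@besselI_binE 1 _ _ t.+1) // !(@besselI_binE _ _ _ t.+2) //
  !(big_nat_recl t.+1) //= !muln0 !addn0 !bin0.
rewrite -addrA; congr (_ + _); rewrite mulr_sumr -big_split /=.
apply: eq_big_nat => l _; rewrite !addn0.
have -> : (2 * l.+1 = (2 * l + 1).+1)%N by lia.
rewrite binS; have -> : 'C((2 * l + 1).+1, l.+1) = (2 * 'C(2 * l + 1, l))%N.
  by rewrite binS -(@bin_sub _ l.+1); [rewrite (_ : (_ - _ = l)%N); lia|lia].
rewrite !natrM natrD exprS.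
by field.
Qed.

Lemma besselISS n c t :
  besselI n.+1 c t.+1
  = besselI n.+1 c t + c / 2 * (besselI n c t + besselI n.+2 c t).
Proof.
have tN : (t < t.+3)%N by lia.
rewrite (@besselI_binE n.+2 _ _ t.+2) // !(@besselI_binE _ _ _ t.+3) //.
set h := c / 2.
have -> : \sum_(0 <= l < t.+3) ('C(t.+1, 2 * l + n.+1)
      * 'C(2 * l + n.+1, l))%:R * h ^+ (2 * l + n.+1)
    = \sum_(0 <= l < t.+3) ('C(t, 2 * l + n.+1)
      * 'C(2 * l + n.+1, l))%:R * h ^+ (2 * l + n.+1)
    + h * \sum_(0 <= l < t.+3) ('C(t, 2 * l + n)
      * 'C(2 * l + n.+1, l))%:R * h ^+ (2 * l + n).
  rewrite mulr_sumr -big_split /=; apply: eq_big_nat => l _.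
  by rewrite !addnS binS mulnDl natrD exprS; ring.
congr (_ + h * _); rewrite !(big_nat_recl t.+2) //= -addrA; congr (_ + _).
  by rewrite !bin0.
rewrite -big_split /=; apply: eq_big_nat => l _.
have -> : (2 * l.+1 + n.+1 = (2 * l + n.+2).+1)%N by lia.
have -> : (2 * l.+1 + n = 2 * l + n.+2)%N by lia.
by rewrite binS mulnDr natrD mulrDl.
Qed.

Lemma besselI_small n c t : (t < n)%N -> besselI n c t = 0.
Proof. by rewrite /besselI ltnNge => /negbTE ->. Qed.

(** Transposition of the Bessel recurrence in k to a recurrence on the sequence B.
The term (-1)^m (I_m B_(m+1) + I_(m+1) B_m) telescopes, and its last value is
0 because I_n(k) = 0 for n > k. *)
Lemma sum_besselIS (c : F) k (B G : nat -> F) :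
  G 0%N = B 1%N -> G 1%N = B 2%N + 2 * B 0%N ->
  (forall m, G m.+2 = B m.+3 + B m.+1) ->
  \sum_(0 <= m < k.+2) (-1) ^+ m * B m * besselI m c k.+1
  = \sum_(0 <= m < k.+1) (-1) ^+ m * (B m - c / 2 * G m) * besselI m c k.
Proof.
move=> G0 G1 GS.
have tele N : \sum_(0 <= m < N.+2) (-1) ^+ m * B m * besselI m c k.+1
  = \sum_(0 <= m < N.+2) (-1) ^+ m * (B m - c / 2 * G m) * besselI m c k
    - c / 2 * (-1) ^+ N
      * (besselI N.+1 c k * B N.+2 + besselI N.+2 c k * B N.+1).
  elim: N => [|N IHN].
    by rewrite !big_nat_recr // !big_geq //= besselI0S besselISS G0 G1; field.
  rewrite big_nat_recr //= IHN [in RHS]big_nat_recr //= besselISS GS !exprS.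
  by field.
rewrite tele !(besselI_small _ (n := k.+1)) // !(besselI_small _ (n := k.+2)) //.
by rewrite big_nat_recr //= besselI_small // !mul0r addr0 !mulr0 addr0 subr0.
Qed.
End Bessel.

(** * The coefficients b_m *)

Section Coefficients.
Variables (R : realType) (V : countType) (e : rel V) (q : nat) (x0 : V).
Hypotheses (e_sym : symmetric e) (e_irr : irreflexive e).
Hypothesis e_regular : regular_graph e q.+1.
Local Notation b := (b_coef R e q x0).
Local Notation nc m x := ((nb_count e x0 m x)%:R : R).

Lemma b_coef0 x : b 0 x = nc 0 x.
Proof. by rewrite /b_coef big_geq // mulr0 addr0. Qed.

Lemma b_coef1 x : b 1 x = nc 1 x.
Proof. by rewrite /b_coef big_geq // mulr0 addr0. Qed.

Lemma b_coefSS m x : b m.+2 x = b m x + nc m.+2 x - q%:R * nc m x.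
Proof.
rewrite /b_coef /= big_nat_recl //=.
rewrite (_ : m.+2 - 2 * 1 = m)%N; last by lia.
rewrite (eq_bigr (fun j => (nb_count e x0 (m - 2 * j) x)%:R)); last first.
  by move=> j _; congr (nb_count _ _ _ _)%:R; lia.
ring.
Qed.

Lemma nb_count_adj0 x : \sum_(y <- nbrs e x) nc 0 y = nc 1 x.
Proof.
rewrite (nb_count_nb_sum e_regular) (nb_sum_sym _ e_sym e_regular) /=.
by apply: eq_bigr => y _; rewrite (nb_count_nb_sum e_regular) /= eq_sym.
Qed.

Lemma nb_count_adjS m x :
  \sum_(y <- nbrs e x) nc m.+1 y = nc m.+2 x + (q + (m == 0))%:R * nc m x.
Proof.
rewrite !(nb_count_nb_sum e_regular).
rewrite ![nb_sum _ _ _ x0](nb_sum_sym _ e_sym e_regular).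
rewrite -(nb_sum_adj e_sym e_regular).
apply: eq_bigr => y _.
by rewrite (nb_count_nb_sum e_regular) (nb_sum_sym _ e_sym e_regular).
Qed.

(** The three cases below say that b_m / q^(m/2) behaves as z^m + z^-m (or as 1 if
m = 0) under multiplication by z + 1/z. *)
Lemma b_coef_adj0 x : \sum_(y <- nbrs e x) b 0 y = b 1 x.
Proof. by under eq_bigr do rewrite b_coef0; rewrite nb_count_adj0 b_coef1. Qed.

Lemma b_coef_adj1 x : \sum_(y <- nbrs e x) b 1 y = b 2 x + 2 * q%:R * b 0 x.
Proof.
under eq_bigr do rewrite b_coef1.
by rewrite nb_count_adjS b_coefSS b_coef0 eqxx addn1 mulrSr; ring.
Qed.

Lemma b_coef_adjSS m x :
  \sum_(y <- nbrs e x) b m.+2 y = b m.+3 x + q%:R * b m.+1 x.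
Proof.
have adjSS k : \sum_(y <- nbrs e x) b k.+2 y = \sum_(y <- nbrs e x) b k y
    + \sum_(y <- nbrs e x) nc k.+2 y - q%:R * \sum_(y <- nbrs e x) nc k y.
  under eq_bigr do rewrite b_coefSS.
  by rewrite !big_split sumrN mulr_sumr.
elim/ltn_ind: m => -[_|[_|m IHm]]; rewrite adjSS nb_count_adjS.
- by rewrite b_coef_adj0 nb_count_adj0 b_coefSS b_coef1 /= addn0; ring.
- rewrite b_coef_adj1 nb_count_adjS !b_coefSS b_coef0 eqxx addn0 addn1 mulrSr.
  ring.
rewrite nb_count_adjS IHm // !(b_coefSS m.+3) (b_coefSS m.+1) /= !addn0.
ring.
Qed.

(** Both sides satisfy the same two-step recurrence, by [closed_count_step].  The
parity term comes from m = 2: there b_2 has the summand (1 - q) c_0(x0), while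
N_2 and c_2 vanish alike. *)
Lemma b_coef_closed m : vertex_transitive e ->
  b m x0 = (N_count e x0 m)%:R + (1 - q%:R) * (~~ odd m && (0 < m)%N)%:R.
Proof.
move=> e_trans.
have c_const n x y := @closed_count_transitive R V e q e_regular n x y e_trans.
have ncE n : nc n x0 = closed_count R e n x0.
  by rewrite (nb_count_nb_sum e_regular).
(* For lengths 1 and 2 there is no tail: it would need a loop or a backtracking
   step. *)
have tl n : (forall u, e x0 u -> edge_kernel R e n x0 u u x0 = 0) ->
    closed_count R e n.+1 x0 = tailless_count R e n.+1 x0.
  move=> t0; rewrite (closed_countE _ e_sym e_regular) big1_seq ?addr0 // => u.
  by rewrite (mem_nbrs e_regular) => /andP[_ /t0].
rewrite (N_count_tailless e_sym e_regular).
elim/ltn_ind: m => -[_|[_|[_|m IHm]]].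
- by rewrite b_coef0 ncE /closed_count /= eqxx mulr0 addr0.
- rewrite b_coef1 ncE tl ?mulr0 ?addr0 // => u; exact: tail_edge0.
- rewrite b_coefSS b_coef0 !ncE tl => [|u _]; last exact: tail_edge1.
  by rewrite [closed_count _ _ 0 _]/closed_count [nb_sum _ 0 _ _]/= eqxx; ring.
have step := closed_count_step e_sym e_irr e_regular c_const m x0.
have -> : (~~ odd m.+3 && (0 < m.+3))%N = (~~ odd m.+1 && (0 < m.+1))%N.
  by rewrite /= !negbK.
rewrite b_coefSS IHm // !ncE -addrA step; ring.
Qed.
End Coefficients.

(** * Solving the wave equation *)

Section Wave.
Variables (R : realType) (V : countType) (e : rel V) (q : nat) (a b : R).
Hypothesis e_regular : regular_graph e q.+1.
Local Notation L := (gen_laplacian e q a b).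

Lemma gen_laplacianE f x :
  L f x = d_ab q a b * f x - b * \sum_(y <- nbrs e x) f y.
Proof.
rewrite /gen_laplacian /laplacian /d_ab fsbig_finite; last exact: nbrs_finite.
by rewrite -/(nbrs e x) mulrBr mulrBl mulrA addrAC.
Qed.

Lemma gen_laplacian_sum (N : nat) (F : nat -> R) (w : nat -> V -> R) x :
  L (fun y => \sum_(0 <= k < N) F k * w k y) x
  = \sum_(0 <= k < N) F k * L (w k) x.
Proof.
rewrite gen_laplacianE exchange_big !mulr_sumr -sumrB /=.
apply: eq_bigr => k _.
by rewrite gen_laplacianE -mulr_sumr; ring.
Qed.

Definition wave_series (w : nat -> V -> R) (s : nat) (x : V) (t : nat) : R :=
  \sum_(0 <= k < t.+1) (-1) ^+ k * 'C(t, 2 * k + s)%:R * w k x.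

(** The binomial coefficients cut the sum off, so every long enough range of
summation gives the same value. *)
Lemma wave_seriesE w s x t N : (forall k, (N <= k)%N -> (t < 2 * k + s)%N) ->
  wave_series w s x t
  = \sum_(0 <= k < N) (-1) ^+ k * 'C(t, 2 * k + s)%:R * w k x.
Proof.
move=> small.
have extend M : (forall k, (M <= k)%N -> (t < 2 * k + s)%N) ->
    \sum_(0 <= k < M) (-1) ^+ k * 'C(t, 2 * k + s)%:R * w k x
    = \sum_(0 <= k < maxn M (maxn N t.+1))
        (-1) ^+ k * 'C(t, 2 * k + s)%:R * w k x.
  move=> smallM; rewrite [RHS](big_cat_nat (leq0n M)) ?leq_maxl //=.
  rewrite [X in _ + X]big1_seq ?addr0 // => k.
  rewrite mem_index_iota => /andP[_ /andP[/smallM tk _]].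
  by rewrite bin_small // mulr0 mul0r.
rewrite (extend N small) /wave_series extend => [|k]; last by lia.
by congr (\sum_(0 <= k < _) _); lia.
Qed.

(** The second difference in t of C(t, 2 (k + 1) + s) is C(t, 2 k + s), and that of
C(t, s) is 0 because s < 2. *)
Lemma wave_series_solves (w : nat -> V -> R) s : (s < 2)%N ->
  (forall k x, L (w k) x = w k.+1 x) ->
  solves_wave e q a b (wave_series w s).
Proof.
move=> s2 wS x t; rewrite /fdiff2.
have low j : (j <= t.+2)%N -> wave_series w s x j
    = \sum_(0 <= k < t.+3) (-1) ^+ k * 'C(j, 2 * k + s)%:R * w k x.
  by move=> jt; apply: wave_seriesE => k; lia.
rewrite [gen_laplacian _ _ _ _ _ _](gen_laplacian_sum _
  (fun k => (-1) ^+ k * 'C(t, 2 * k + s)%:R)).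
have -> : \sum_(0 <= k < t.+1) (-1) ^+ k * 'C(t, 2 * k + s)%:R * L (w k) x
    = \sum_(0 <= k < t.+2) (-1) ^+ k * 'C(t, 2 * k + s)%:R * w k.+1 x.
  rewrite [RHS]big_nat_recr //= bin_small ?mulr0 ?mul0r ?addr0; last by lia.
  by apply: eq_bigr => k _; rewrite wS.
have tt2 : (t <= t.+2)%N by lia.
rewrite !low // mulr_sumr -sumrB -big_split [X in _ + X]big_nat_recl //=.
rewrite addrCA -big_split big1 /= ?addr0 => [|k _].
  rewrite muln0 add0n; case: s s2 {low} => [|[|//]] _;
    rewrite ?bin0 ?bin1 ?mulrS; ring.
have -> : (2 * k.+1 + s = (2 * k + s).+2)%N by lia.
by rewrite !binS !natrD exprS; ring.
Qed.

Lemma wave_series_W x0 W (w : nat -> V -> R) :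
  (forall x, w 0 x = (x == x0)%:R) -> (forall k x, L (w k) x = w k.+1 x) ->
  is_wave_kernel_W e q a b x0 W -> W = wave_series w 0.
Proof.
move=> w0 wS W_ker; have [u [_ uniq_u]] := wave_ivp_exists_unique e q a b
  (fun x => (x == x0)%:R) (fun=> 0).
rewrite -(uniq_u _ W_ker); apply: uniq_u; split.
- exact: wave_series_solves.
- by move=> x; rewrite /wave_series big_nat1 w0 bin0 !mul1r.
- move=> x; rewrite /fdiff /wave_series big_nat1 big_nat_recr //= big_nat1.
  by rewrite !bin0 bin_small // mulr0 mul0r addr0 subrr.
Qed.

Lemma wave_series_V x0 U (w : nat -> V -> R) :
  (forall x, w 0 x = (x == x0)%:R) -> (forall k x, L (w k) x = w k.+1 x) ->
  is_wave_kernel_V e q a b x0 U -> U = wave_series w 1.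
Proof.
move=> w0 wS U_ker; have [u [_ uniq_u]] := wave_ivp_exists_unique e q a b
  (fun=> 0) (fun x => (x == x0)%:R).
rewrite -(uniq_u _ U_ker); apply: uniq_u; split.
- exact: wave_series_solves.
- by move=> x; rewrite /wave_series big_nat1 mulr0 mul0r.
- move=> x; rewrite /fdiff /wave_series big_nat1 big_nat_recr //= big_nat1.
  rewrite w0 binn (@bin_small 0) // (@bin_small 1) //.
  by rewrite !mulr0 !mul0r addr0 subr0 !mul1r.
Qed.

(** For b > 0 even d >= b (q + 1); for b < 0 the bound on a gives
d >= |b| ((sqrt q + 1)^2 - (q + 1)) = 2 |b| sqrt q. *)
Lemma d_ab_neq0 :
  b != 0 -> (1 <= q)%N -> spectral_edge e q a b -> d_ab q a b != 0.
Proof.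
move=> b0 q1 [bpos bfin binf].
have sq : (Num.sqrt q%:R : R) ^+ 2 = q%:R by rewrite sqr_sqrtr ?ler0n.
have s0 : 0 < (Num.sqrt q%:R : R) by rewrite sqrtr_gt0 ltr0n.
have qE : (q.+1)%:R = (Num.sqrt q%:R : R) ^+ 2 + 1 by rewrite sq -addn1 natrD.
rewrite /d_ab qE; set s := Num.sqrt _ in s0 qE bfin binf *.
have [b_gt0|b_lt0|bE] := ltgtP 0 b; last by rewrite bE eqxx in b0.
  by apply: lt0r_neq0; have := bpos b_gt0; nra.
have aE : a <= - `|b| * (s + 1) ^+ 2.
  have [fV|iV] := pselect (finite_set [set: V]%classic); last exact: binf.
  have [lam _ /le_trans] := bfin b_lt0 fV; apply.
  by rewrite !mulNr lerN2 ler_wpM2l // le_max lexx orbT.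
apply: lt0r_neq0; move: aE; rewrite ltr0_norm // opprK; nra.
Qed.
End Wave.

(** * Powers of the Laplacian on the Dirac mass *)

Lemma sum_even_index (R : pzRingType) (f : nat -> R) k :
  \sum_(1 <= j < k./2.+1) f (2 * j)%N
  = \sum_(0 <= m < k.+1) (~~ odd m && (0 < m)%N)%:R * f m.
Proof.
elim: k => [|n IHn]; first by rewrite big_nat1 big_geq // mul0r.
rewrite [RHS]big_nat_recr //= -IHn andbT negbK.
have [on|en] := boolP (odd n).
  rewrite (_ : uphalf n = n./2.+1); last by lia.
  by rewrite big_nat_recr //= mul1r (_ : 2 * n./2.+1 = n.+1)%N //; lia.
by rewrite mul0r addr0 (_ : uphalf n = n./2) //; lia.
Qed.

Section Iterates.
Variables (R : realType) (V : countType) (e : rel V) (q : nat) (x0 : V) (a b : R).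
Hypotheses (e_sym : symmetric e) (e_irr : irreflexive e).
Hypothesis e_regular : regular_graph e q.+1.
Hypotheses (q_ge1 : (1 <= q)%N) (d_neq0 : d_ab q a b != 0).

(** The closed form for the k-th power of the Laplacian applied to the Dirac mass
at x0. *)
Definition lap_iter (k : nat) (x : V) : R :=
  d_ab q a b ^+ k
  * \sum_(0 <= m < k.+1) (-1) ^+ m * b_coef R e q x0 m x * Num.sqrt q%:R ^- m
      * besselI m (c_ab q a b) k.

Lemma lap_iter0 x : lap_iter 0 x = (x == x0)%:R.
Proof.
rewrite /lap_iter big_nat1 b_coef0 (nb_count_nb_sum e_regular) /= /besselI /=.
by rewrite big_nat1 !expr0 invr1 eq_sym !mulr1 !mul1r.
Qed.

(** The Laplacian is d (I - (c/2) A/s), because b s = d c / 2; on the functions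
B_m = b_m / s^m the operator A/s is the one that [sum_besselIS] transposes. *)
Lemma lap_iterS k x : gen_laplacian e q a b (lap_iter k) x = lap_iter k.+1 x.
Proof.
set s : R := Num.sqrt q%:R.
have sq : q%:R = s ^+ 2 by rewrite sqr_sqrtr ?ler0n.
have s0 : s != 0 by rewrite gt_eqF // sqrtr_gt0 ltr0n.
pose B m := b_coef R e q x0 m x * s ^- m.
pose G m := s^-1 * (\sum_(y <- nbrs e x) b_coef R e q x0 m y) * s ^- m.
have bs : b * s = d_ab q a b * (c_ab q a b / 2).
  by rewrite /c_ab -/(d_ab q a b) -/s; field.
rewrite (gen_laplacianE _ _ e_regular) /lap_iter exprS -mulrA.
under [in RHS]eq_bigr do rewrite -(mulrA (_ ^+ _)).
rewrite (@sum_besselIS _ _ _ B G); first last.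
- move=> m; rewrite /G /B (b_coef_adjSS _ _ e_sym e_regular) sq !exprS.
  by field; rewrite expf_neq0 s0.
- by rewrite /G /B (b_coef_adj1 _ _ e_sym e_regular) sq; field; rewrite s0.
- by rewrite /G /B (b_coef_adj0 _ _ e_sym e_regular) expr0 expr1; field.
rewrite -mulr_sumr exchange_big /= mulrCA [b * _]mulrCA -mulrBr mulrCA.
congr (_ * _).
rewrite !mulr_sumr -sumrB; apply: eq_bigr => m _.
rewrite -!mulr_suml -mulr_sumr.
have -> : \sum_(y <- nbrs e x) b_coef R e q x0 m y = s * G m * s ^+ m.
  by rewrite /G; field; rewrite expf_neq0.
have sm0 : s ^+ m != 0 by rewrite expf_neq0.
transitivity (d_ab q a b * ((-1) ^+ m * B m * besselI m (c_ab q a b) k)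
  - b * s * ((-1) ^+ m * G m * besselI m (c_ab q a b) k)).
  by rewrite /B -/s; field.
by rewrite bs; ring.
Qed.

Lemma lap_iter_closed k : vertex_transitive e ->
  lap_iter k x0 = d_ab q a b ^+ k
  * (\sum_(0 <= m < k.+1) (-1) ^+ m * (N_count e x0 m)%:R * Num.sqrt q%:R ^- m
       * besselI m (c_ab q a b) k
     + (1 - q%:R) * \sum_(1 <= j < k./2.+1)
         q%:R ^- j * besselI (2 * j) (c_ab q a b) k).
Proof.
move=> e_trans; congr (_ * _).
have := sum_even_index (fun m => Num.sqrt q%:R ^- m * besselI m (c_ab q a b) k) k.
under eq_bigr do rewrite exprM sqr_sqrtr ?ler0n //.
move=> ->; rewrite mulr_sumr -big_split /=; apply: eq_bigr => m _.
rewrite (b_coef_closed _ _ e_sym e_irr e_regular _ e_trans).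
case: (boolP (odd m)) => om /=; first by rewrite mulr0 addr0 mul0r mulr0 addr0.
by rewrite -signr_odd (negbTE om) expr0; ring.
Qed.
End Iterates.

(** * The wave kernels *)

(* [Num.sqrt q%:R ^- m] is q^(-m/2). The sums over [k < t.+1./2] range over
   0 <= k <= floor((t-1)/2), and are empty for t = 0. *)
Theorem theorem1p1 (R : realType) (V : countType) (e : rel V) (q : nat)
    (x0 : V) (a b : R) (W U : V -> nat -> R)
    (q_ge1 : (1 <= q)%N)
    (e_simple : simple_graph e)
    (e_connected : connected_graph e)
    (e_regular : regular_graph e q.+1)
    (b_neq0 : b != 0)
    (ab_edge : spectral_edge e q a b)
    (W_kernel : is_wave_kernel_W e q a b x0 W)
    (U_kernel : is_wave_kernel_V e q a b x0 U) :
  [/\ forall (x : V) (t : nat),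
        W x t = \sum_(0 <= k < t./2.+1)
          (-1) ^+ k * 'C(t, 2 * k)%:R * d_ab q a b ^+ k
          * \sum_(0 <= m < k.+1)
              (-1) ^+ m * b_coef R e q x0 m x * Num.sqrt q%:R ^- m
              * besselI m (c_ab q a b) k,
      forall (x : V) (t : nat),
        U x t = \sum_(0 <= k < t.+1./2)
          (-1) ^+ k * 'C(t, 2 * k + 1)%:R * d_ab q a b ^+ k
          * \sum_(0 <= m < k.+1)
              (-1) ^+ m * b_coef R e q x0 m x * Num.sqrt q%:R ^- m
              * besselI m (c_ab q a b) k
    & vertex_transitive e -> forall t : nat,
        W x0 t = \sum_(0 <= k < t./2.+1)
          (-1) ^+ k * 'C(t, 2 * k)%:R * d_ab q a b ^+ k
          * (\sum_(0 <= m < k.+1)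
               (-1) ^+ m * (N_count e x0 m)%:R * Num.sqrt q%:R ^- m
               * besselI m (c_ab q a b) k
             + (1 - q%:R) * \sum_(1 <= j < k./2.+1)
                 q%:R ^- j * besselI (2 * j) (c_ab q a b) k)
        /\
        U x0 t = \sum_(0 <= k < t.+1./2)
          (-1) ^+ k * 'C(t, 2 * k + 1)%:R * d_ab q a b ^+ k
          * (\sum_(0 <= m < k.+1)
               (-1) ^+ m * (N_count e x0 m)%:R * Num.sqrt q%:R ^- m
               * besselI m (c_ab q a b) k
             + (1 - q%:R) * \sum_(1 <= j < k./2.+1)
                 q%:R ^- j * besselI (2 * j) (c_ab q a b) k)].
Proof.
have [e_sym e_irr] := e_simple.
have d_neq0 := d_ab_neq0 b_neq0 q_ge1 ab_edge.
have w0 := lap_iter0 x0 a b e_regular.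
have wS := lap_iterS x0 e_sym e_regular q_ge1 d_neq0.
have WE x t : W x t = \sum_(0 <= k < t./2.+1)
    (-1) ^+ k * 'C(t, 2 * k)%:R * lap_iter e q x0 a b k x.
  rewrite (wave_series_W e_regular w0 wS W_kernel).
  rewrite (@wave_seriesE _ _ _ _ _ _ t./2.+1).
    by apply: eq_bigr => k _; rewrite addn0.
  by move=> k; lia.
have UE x t : U x t = \sum_(0 <= k < t.+1./2)
    (-1) ^+ k * 'C(t, 2 * k + 1)%:R * lap_iter e q x0 a b k x.
  rewrite (wave_series_V e_regular w0 wS U_kernel).
  rewrite (@wave_seriesE _ _ _ _ _ _ t.+1./2) //.
  by move=> k; lia.
split=> [x t|x t|e_trans t].
- by rewrite WE; apply: eq_bigr => k _; rewrite mulrA.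
- by rewrite UE; apply: eq_bigr => k _; rewrite mulrA.
have closed := lap_iter_closed x0 a b e_sym e_irr e_regular _ e_trans.
by split; rewrite ?WE ?UE; apply: eq_bigr => k _; rewrite closed mulrA.
Qed.
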